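(* For every integer $v \ge 6$ there exists an idempotent $\mathrm{MCQLS}(v)$, except possibly when $v \in \{6,8,10,12,14,18,20,24,26,30,32,38,62\}$. (Existence is asserted for all other $v\ge 6$; nothing is asserted for the listed values.)
   Context: $\mathcal{H}_n=\mathbb{C}^n$ denotes the $n$-dimensional complex Hilbert space. A quantum Latin square of order $n$, $\mathrm{QLS}(n)$, is an $n\times n$ array whose entries are unit column vectors of $\mathcal{H}_n$ such that the entries of each row and of each column form an orthonormal basis of $\mathcal{H}_n$. Two unit vectors $u,v$ are regarded as identical if $u=e^{i\theta}v$ for some real $\theta$, and as distinct otherwise. An $\mathrm{MCQLS}(n)$ is a $\mathrm{QLS}(n)$ of maximum cardinality, i.e. all its $n^2$ entries are pairwise distinct (up to global phase). A $\mathrm{QLS}(n)$ is idempotent if the entries on its main diagonal form an orthonormal basis of $\mathcal{H}_n$. *)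

(* Defs.v *)
From mathcomp Require Import all_boot all_order all_algebra.
From mathcomp Require Import reals trigo complex.

Set Implicit Arguments.
Unset Strict Implicit.
Unset Printing Implicit Defensive.

Import Order.TTheory GRing.Theory Num.Theory.
Local Open Scope ring_scope.
Local Open Scope complex_scope.

(* H_n is 'cV[R[i]]_n; the inner product is conjugate-linear on the left. *)
Definition inner (R : realType) (n : nat) (u w : 'cV[R[i]]_n) : R[i] :=
  \sum_(k < n) (u k 0)^* * w k 0.

Definition hnorm (R : realType) (n : nat) (u : 'cV[R[i]]_n) : R[i] :=
  sqrtC (inner u u).

Definition unit_vector (R : realType) (n : nat) (u : 'cV[R[i]]_n) : Prop :=
  hnorm u = 1.

Definition orthonormal_basis (R : realType) (n : nat)
    (e : 'I_n -> 'cV[R[i]]_n) : Prop :=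
  [/\ forall i, unit_vector (e i),
      forall i j, i != j -> inner (e i) (e j) = 0
    & basis_of {: 'cV[R[i]]_n} [seq e i | i <- enum 'I_n]].

Definition expi (R : realType) (theta : R) : R[i] := cos theta +i* sin theta.

Definition same_up_to_phase (R : realType) (n : nat)
    (u w : 'cV[R[i]]_n) : Prop :=
  exists theta : R, u = expi theta *: w.

Definition is_QLS (R : realType) (n : nat)
    (L : 'I_n -> 'I_n -> 'cV[R[i]]_n) : Prop :=
  [/\ forall i j, unit_vector (L i j),
      forall i, orthonormal_basis (fun j => L i j)
    & forall j, orthonormal_basis (fun i => L i j)].

Definition is_MCQLS (R : realType) (n : nat)
    (L : 'I_n -> 'I_n -> 'cV[R[i]]_n) : Prop :=
  is_QLS L /\
  forall i j k l, (i, j) != (k, l) -> ~ same_up_to_phase (L i j) (L k l).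

Definition idempotent_QLS (R : realType) (n : nat)
    (L : 'I_n -> 'I_n -> 'cV[R[i]]_n) : Prop :=
  is_QLS L /\ orthonormal_basis (fun i => L i i).

(* Main.v *)
Require Import Defs.
From mathcomp Require Import all_boot all_order all_algebra.
From mathcomp Require Import reals complex.
From mathcomp Require Import separable cyclic cyclotomic zify ring.

(** The entrywise products [H_i G_j / sqrt n] of the rows of two complex
    Hadamard matrices form a quantum Latin square.  Taking for [H] and [G] the
    Fourier matrix of Z/n with the columns of one of them permuted by [p], the
    square has maximum cardinality when [p] is far enough from being affine, and
    it is idempotent when [k |-> p k - k] is also a permutation; the analogue
    over other groups gives the orders 8 and 16 (the Hadamard squares are due to
    Musto and Vicary).

    Squares are composed as follows.  Blow up each cell of an idempotent
    Latin square of order m to an n x n block holding an MCQLS(n), rotated by a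
    generic unitary so that no vector occurs in two blocks.  Along w disjoint
    transversals use instead an MCQLS(n + 1) whose extra row, column and basis
    vector are shared by the transversal, and put an idempotent MCQLS(w) in the
    w x w corner.  This gives order m n + w for all odd m >= w, provided that the
    blocks on the main diagonal are idempotent.  With n = 6 or 7 and
    7 <= w <= 19 it reaches all large orders, and finitely many remain. *)

Set Implicit Arguments.
Unset Strict Implicit.
Unset Printing Implicit Defensive.

Import Order.TTheory GRing.Theory Num.Theory.
Local Open Scope ring_scope.

(** * Vectors and unitary operators *)

Section Vectors.
Variable C : numClosedFieldType.

Definition dot (T : finType) (u w : T -> C) : C := \sum_k (u k)^* * w k.

Definition orthonormal_family (I : eqType) (T : finType) (e : I -> T -> C) : Prop :=
  forall i j, dot (e i) (e j) = (i == j)%:R.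

(** Any scalar is allowed, even zero, so the negation is at least as strong as being distinct up to
    phase; the relation is not symmetric at the zero vector. *)
Definition proportional (T : Type) (u w : T -> C) : Prop :=
  exists c : C, forall k, u k = c * w k.

Definition matvec (T : finType) (U : T -> T -> C) (u : T -> C) (k : T) : C :=
  \sum_l U k l * u l.

Definition unitary_op (T : finType) (U : T -> T -> C) : Prop :=
  forall a b, \sum_k (U k a)^* * U k b = (a == b)%:R.

Lemma eq_dot (T : finType) (u u' w w' : T -> C) :
  u =1 u' -> w =1 w' -> dot u w = dot u' w'.
Proof. by move=> eu ew; apply: eq_bigr => k _; rewrite eu ew. Qed.

Lemma dot_conj (T : finType) (u w : T -> C) : (dot u w)^* = dot w u.
Proof.
rewrite /dot rmorph_sum; apply: eq_bigr => k _ /=.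
by rewrite rmorphM /= conjCK mulrC.
Qed.

Lemma dot_eq0 (T : finType) (u : T -> C) : dot u u = 0 -> forall k, u k = 0.
Proof.
move=> u0 k; apply/eqP; rewrite -mul_conjC_eq0 mulrC; apply/eqP.
move: u0; rewrite /dot => /psumr_eq0P-> // i _; rewrite mulrC mul_conjC_ge0 //.
Qed.

Lemma dot_unit (T : finType) (x : T) (w : T -> C) :
  dot (fun k => (k == x)%:R) w = w x.
Proof.
rewrite /dot (bigD1 x) //= eqxx rmorph1 mul1r big1 ?addr0 // => k /negPf->.
by rewrite rmorph0 mul0r.
Qed.

Lemma dot_matvec (T : finType) (U : T -> T -> C) (u w : T -> C) :
  unitary_op U -> dot (matvec U u) (matvec U w) = dot u w.
Proof.
move=> uU; rewrite /dot /matvec.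
under eq_bigr => k _ do rewrite rmorph_sum big_distrlr /=.
rewrite exchange_big; apply: eq_bigr => a _ /=.
transitivity (\sum_b (u a)^* * w b * \sum_k (U k a)^* * U k b).
  rewrite exchange_big; apply: eq_bigr => b _ /=; rewrite mulr_sumr.
  by apply: eq_bigr => k _; rewrite rmorphM mulrACA mulrC.
rewrite (bigD1 a) //= uU eqxx mulr1 big1 ?addr0 // => b /negPf ba.
by rewrite uU eq_sym ba mulr0.
Qed.

Lemma matvec_inj (T : finType) (U : T -> T -> C) (u w : T -> C) :
  unitary_op U -> matvec U u =1 matvec U w -> u =1 w.
Proof.
move=> uU e k; apply/eqP; rewrite -subr_eq0; apply/eqP.
apply: (@dot_eq0 _ (fun k => u k - w k)); rewrite -(dot_matvec _ _ uU).
rewrite /dot big1 // => a _; rewrite {2}/matvec.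
under eq_bigr => l _ do rewrite mulrBr.
by rewrite sumrB -/(matvec U u a) e subrr mulr0.
Qed.

Lemma matvec_scale (T : finType) (U : T -> T -> C) (c : C) (u w : T -> C) :
  (forall k, u k = c * w k) -> forall k, matvec U u k = c * matvec U w k.
Proof.
by move=> e k; rewrite /matvec mulr_sumr; apply: eq_bigr => l _; rewrite e mulrCA.
Qed.

Lemma matvec_proportional (T : finType) (U : T -> T -> C) (u w : T -> C) :
  unitary_op U -> proportional (matvec U u) (matvec U w) -> proportional u w.
Proof.
move=> uU [c e]; exists c; apply: (matvec_inj uU) => k.
by rewrite e; apply/esym/matvec_scale.
Qed.

(** A left inverse of a square matrix is also a right inverse. *)
Lemma orthonormal_dual (T : finType) (e : T -> T -> C) :
  orthonormal_family e -> forall a b, \sum_k (e k a)^* * e k b = (a == b)%:R.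
Proof.
move=> oe a b.
pose E : 'M[C]_#|T| := \matrix_(i, j) (e (enum_val i) (enum_val j)).
pose F : 'M[C]_#|T| := \matrix_(i, j) (e (enum_val j) (enum_val i))^*.
have bij := onW_bij xpredT (@enum_val_bij T).
have /mulmx1C/matrixP/(_ (enum_rank a) (enum_rank b)) : E *m F = 1%:M.
  apply/matrixP => i j; rewrite !mxE -(inj_eq enum_val_inj) eq_sym -oe.
  rewrite /dot (reindex _ bij) /=.
  by apply: eq_bigr => k _; rewrite !mxE mulrC.
rewrite !mxE (inj_eq enum_rank_inj) => <-.
rewrite (reindex _ bij) /=; apply: eq_bigr => k _ /=.
by rewrite !mxE !enum_rankK.
Qed.
End Vectors.

(** * Generic unitaries *)

Section Generic.
Variable C : numClosedFieldType.

Lemma exists_nat_nonroot (p : {poly C}) : p != 0 -> exists t : nat, ~~ root p t%:R.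
Proof.
move=> p0; have [/allPn[_ /mapP[t _ ->] ?]|rp] :=
  boolP (~~ all (root p) [seq t%:R | t <- iota 0 (size p)]); first by exists t.
have := max_poly_roots p0 (negbNE rp); rewrite map_inj_uniq ?iota_uniq.
  by rewrite size_map size_iota ltnn => /(_ isT).
by move=> a b /eqP; rewrite eqr_nat => /eqP.
Qed.

(** The Householder reflection in a real vector [x]; without conjugates it is rational in [x]. *)
Definition reflection (T : finType) (x : T -> C) (k l : T) : C :=
  (k == l)%:R - 2%:R / (\sum_a x a ^+ 2) * (x k * x l).

Lemma matvec_reflection (T : finType) (x u : T -> C) (k : T) :
  matvec (reflection x) u k =
  u k - 2%:R / (\sum_a x a ^+ 2) * (\sum_l x l * u l) * x k.
Proof.
rewrite /matvec /reflection; under eq_bigr => l _ do rewrite mulrBl.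
rewrite sumrB (bigD1 k) //= eqxx mul1r big1 ?addr0 => [|l].
  congr (_ - _); rewrite mulr_sumr mulr_suml; apply: eq_bigr => l _.
  by ring.
by rewrite eq_sym => /negPf->; rewrite mul0r.
Qed.

Lemma reflection_unitary (T : finType) (x : T -> C) :
  (forall k, (x k)^* = x k) -> \sum_a x a ^+ 2 != 0 -> unitary_op (reflection x).
Proof.
move=> xR s0 a b; set s := \sum_a _ in s0 *.
have sR : s^* = s.
  by rewrite /s rmorph_sum; apply: eq_bigr => k _; rewrite rmorphXn /= xR.
transitivity (matvec (reflection x) (fun k => reflection x k b) a).
  apply: eq_bigr => k _; congr (_ * _).
  rewrite /reflection rmorphB !rmorphM /= !xR fmorphV /= sR !rmorph_nat.
  by rewrite eq_sym (mulrC (x a)).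
rewrite matvec_reflection -/s.
have -> : \sum_l x l * reflection x l b = - x b.
  rewrite /reflection -/s; under eq_bigr => l _ do rewrite mulrBr.
  rewrite sumrB (bigD1 b) //= eqxx mulr1 big1 ?addr0 => [|l /negPf->]; last by rewrite mulr0.
  transitivity (x b - 2%:R / s * x b * s).
    congr (_ - _); rewrite {3}/s mulr_sumr; apply: eq_bigr => l _.
    by ring.
  by rewrite mulrAC divfK // mulr_natl mulr2n opprD addrA subrr add0r.
by rewrite /reflection -/s; ring.
Qed.

(** A point of the moment curve: pairing it with a fixed nonzero vector gives a nonzero polynomial
    in [t]. *)
Definition moment (n t : nat) (k : 'I_n) : C := t%:R ^+ k.

Lemma moment_poly (n t : nat) (u : 'I_n -> C) :
  \sum_k moment t k * u k = (\poly_(k < n) oapp u 0 (insub k)).[t%:R].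
Proof.
rewrite horner_poly; apply: eq_bigr => k _.
by rewrite valK mulrC.
Qed.

Lemma moment_poly_neq0 (n : nat) (u : 'I_n -> C) (k : 'I_n) :
  u k != 0 -> \poly_(k < n) oapp u 0 (insub k) != 0.
Proof.
apply: contraNneq => /polyP/(_ k); rewrite coef_poly ltn_ord valK coef0 /=.
by move=> ->.
Qed.

Lemma exists_annihilator (n : nat) (s s' : 'I_n -> C) : (2 < n)%N ->
  exists f : 'I_n -> C, [/\ exists k, f k != 0, \sum_k f k * s k = 0
                          & \sum_k f k * s' k = 0].
Proof.
move=> n2; pose B : 'M[C]_(n, 2) := \matrix_(k, j) (if j == 0 then s k else s' k).
have : kermx B != 0.
  by rewrite -mxrank_eq0 mxrank_ker subn_eq0 -ltnNge (leq_ltn_trans (rank_leq_col B)).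
case/rowV0Pn => f /sub_kermxP fB /rV0Pn[k fk].
exists (f 0); split; first by exists k.
  by have /matrixP/(_ 0 0) := fB; rewrite !mxE => {2}<-; apply: eq_bigr => i _; rewrite mxE.
by have /matrixP/(_ 0 1) := fB; rewrite !mxE => {2}<-; apply: eq_bigr => i _; rewrite mxE.
Qed.

(* If the reflection U in x maps s into the line of s', then either x is
   orthogonal to s, or x lies in the span of s and s'; for n > 2 both conditions
   are nontrivial polynomial equations along the moment curve. *)
Lemma exists_separating_unitary (n : nat) (K : finType) (s s' : K -> 'I_n -> C) :
    (2 < n)%N ->
  exists2 U : 'I_n -> 'I_n -> C, unitary_op U &
    forall k, (exists i, s k i != 0) -> ~ proportional (matvec U (s k)) (s' k).
Proof.
move=> n2; have n0 : (0 < n)%N by lia.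
have /fin_all_exists[f fP] := fun k => exists_annihilator (s k) (s' k) n2.
pose P (u : 'I_n -> C) : {poly C} := \poly_(k < n) oapp u 0 (insub k).
have P0 u : (exists i, u i != 0) -> P u != 0 by case=> i; apply: moment_poly_neq0.
(* Indices with [s k = 0] are skipped, so [G] is nonzero and one nonroot [t] serves every other [k].
   A natural number [t] makes the moment vector real. *)
pose G := \prod_(k | P (s k) != 0) (P (s k) * P (f k)).
have [|t] := @exists_nat_nonroot G.
  by apply/prodf_neq0 => k sk; rewrite mulf_neq0 // P0 //; case: (fP k).
rewrite /root /G horner_prod => /prodf_neq0 tG.
have norm0 : \sum_a @moment n t a ^+ 2 != 0.
  rewrite psumr_neq0; last by move=> k _; rewrite -exprM exprn_ge0 ?ler0n.
  apply/hasP; exists (Ordinal n0); first exact: mem_index_enum.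
  by rewrite /= /moment expr0 expr1n ltr01.
exists (reflection (moment t)).
  apply: reflection_unitary => // k.
  by rewrite /moment rmorphXn /= rmorph_nat.
move=> k sk [c e]; have := tG k (P0 _ sk); rewrite hornerM -!moment_poly.
have [_ fs fs'] := fP k.
set a := \sum_k _; set b := \sum_k _; case/negP.
(* Pairing with [f k] kills both [s k] and [s' k]; only a nonzero multiple of [a * b] survives in
   the reflection formula. *)
have : \sum_i f k i * matvec (reflection (moment t)) (s k) i = 0.
  under eq_bigr => i _ do rewrite e mulrCA.
  by rewrite -mulr_sumr fs' mulr0.
under eq_bigr => i _ do rewrite matvec_reflection mulrBr mulrCA.
rewrite sumrB fs sub0r => /eqP; rewrite oppr_eq0 -mulr_sumr.
have -> : \sum_i f k i * moment t i = b by apply: eq_bigr => i _; rewrite mulrC.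
rewrite -/a; set S := \sum_k _ in norm0 *; rewrite -[_ * b]mulrA mulf_eq0.
by rewrite (negPf (mulf_neq0 _ _)) ?invr_neq0 ?pnatr_eq0.
Qed.

(** The unitaries are chosen one after another, each separating the family from its finitely many
    images under the earlier ones. *)
Lemma exists_generic_unitaries (n : nat) (J K : finType) (s : K -> 'I_n -> C) :
    (2 < n)%N ->
  exists U : J -> 'I_n -> 'I_n -> C, (forall a, unitary_op (U a)) /\
    forall a b k l, a != b -> (exists i, s k i != 0) -> (exists i, s l i != 0) ->
      ~ proportional (matvec (U a) (s k)) (matvec (U b) (s l)).
Proof.
move=> n2.
suff [V [uV V_gen]] : exists V : nat -> 'I_n -> 'I_n -> C,
    (forall a, unitary_op (V a)) /\
    forall a b k l, (a < b < #|J|)%N -> (exists i, s k i != 0) ->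
      ~ proportional (matvec (V b) (s k)) (matvec (V a) (s l)).
  exists (fun a => V (enum_rank a)); split=> // a b k l ab sk sl.
  have [lt_ab|lt_ba|/val_inj/enum_rank_inj/eqP] :=
    ltngtP (enum_rank a) (enum_rank b); last by rewrite (negPf ab).
    move=> [c e]; apply: (V_gen (enum_rank a) (enum_rank b) l k _ sl).
      by rewrite lt_ab ltn_ord.
    (* Reversing the relation needs [c] invertible; [c = 0] would force [s k = 0]. *)
    have c0 : c != 0.
      apply: contraPneq sk => c0 [i /eqP[]]; move: i.
      apply: (matvec_inj (uV (enum_rank a))) => i; rewrite e c0 mul0r /matvec.
      by rewrite big1 // => j _; rewrite mulr0.
    by exists c^-1 => i; rewrite e mulKf.
  by apply: V_gen => //; rewrite lt_ba ltn_ord.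
elim: #|J| => [|m [V [uV V_gen]]].
  exists (fun _ k l => (k == l)%:R); split=> [_ a b|a b]; last by rewrite ltn0 andbF.
  rewrite (bigD1 a) //= eqxx rmorph1 mul1r big1 ?addr0 // => k /negPf->.
  by rewrite rmorph0 mul0r.
have [W uW W_gen] := @exists_separating_unitary n (K * K * 'I_m)%type
  (fun x => s x.1.1) (fun x => matvec (V x.2) (s x.1.2)) n2.
exists (fun b => if (b < m)%N then V b else W); split=> [a|a b k l].
  by case: ifP.
case/andP => ab; rewrite ltnS leq_eqVlt => /predU1P[bm|bm] sk.
  rewrite -{}bm in W W_gen uW *; rewrite ltnn ab.
  exact: (W_gen (k, l, Ordinal ab) sk).
by rewrite bm (ltn_trans ab bm); apply: V_gen => //; rewrite ab.
Qed.
End Generic.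

(** * Quantum Latin squares from Hadamard matrices *)

Section Squares.
Variable C : numClosedFieldType.

Definition max_qls (T : finType) (L : T -> T -> T -> C) : Prop :=
  [/\ forall i, orthonormal_family (L i),
      forall j, orthonormal_family (fun i => L i j)
    & forall i j k l, (i, j) != (k, l) -> ~ proportional (L i j) (L k l)].

Definition orthonormal_diag (T : finType) (L : T -> T -> T -> C) : Prop :=
  orthonormal_family (fun i => L i i).

Definition has_mc (n : nat) : Prop :=
  exists L : 'I_n -> 'I_n -> 'I_n -> C, max_qls L.

Definition has_imc (n : nat) : Prop :=
  exists L : 'I_n -> 'I_n -> 'I_n -> C, max_qls L /\ orthonormal_diag L.

Lemma max_qls_reindex (S T : finType) (f : S -> T) (L : T -> T -> T -> C) :
    bijective f -> max_qls L ->
  max_qls (fun i j k => L (f i) (f j) (f k)).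
Proof.
move=> bij_f [rL cL dL]; have inj_f := bij_inj bij_f.
have dotf u w : dot (fun k => u (f k)) (fun k => w (f k)) = dot u w :> C.
  by rewrite /dot [RHS](reindex f) //; apply: onW_bij.
split=> [i a b|j a b|i j k l ne [c e]].
- by rewrite (dotf (L _ _) (L _ _)) rL (inj_eq inj_f).
- by rewrite (dotf (L _ _) (L _ _)) cL (inj_eq inj_f).
apply: (dL (f i) (f j) (f k) (f l)); first by rewrite xpair_eqE !(inj_eq inj_f).
by exists c => x; have [g _ gK] := bij_f; rewrite -(gK x).
Qed.

Lemma idempotent_reindex (S T : finType) (f : S -> T) (L : T -> T -> T -> C) :
    bijective f -> orthonormal_diag L ->
  orthonormal_diag (fun i j k => L (f i) (f j) (f k)).
Proof.
move=> bij_f iL a b; rewrite -(inj_eq (bij_inj bij_f)) -iL.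
by rewrite /dot [RHS](reindex f) //; apply: onW_bij.
Qed.

Lemma has_imcP (T : finType) (L : T -> T -> T -> C) :
  max_qls L -> orthonormal_diag L -> has_imc #|T|.
Proof.
move=> mL iL; exists (fun i j k => L (enum_val i) (enum_val j) (enum_val k)).
by split; [apply: max_qls_reindex|apply: idempotent_reindex] => //; apply: enum_val_bij.
Qed.

Lemma max_qls_on (n : nat) (T : finType) (L : 'I_n -> 'I_n -> 'I_n -> C) :
    #|T| = n -> max_qls L ->
  exists2 L' : T -> T -> T -> C, max_qls L' & orthonormal_diag L -> orthonormal_diag L'.
Proof.
move=> Tn mL; subst n.
exists (fun i j k => L (enum_rank i) (enum_rank j) (enum_rank k)).
  by apply: max_qls_reindex => //; apply: enum_rank_bij.
by apply: idempotent_reindex; apply: enum_rank_bij.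
Qed.

(** The unitary sending row [x] to the standard basis is applied to every entry. In the composition
    this makes the corner of an ingredient a coordinate vector. *)
Lemma max_qls_normalize (T : finType) (x : T) (L : T -> T -> T -> C) :
    max_qls L ->
  exists L' : T -> T -> T -> C, [/\ max_qls L', orthonormal_diag L -> orthonormal_diag L'
    & forall j k, L' x j k = (j == k)%:R].
Proof.
move=> [rL cL dL]; pose U k l : C := (L x k l)^*.
have uU : unitary_op U.
  move=> a b; rewrite eq_sym -(orthonormal_dual (rL x)).
  by apply: eq_bigr => k _; rewrite /U conjCK mulrC.
exists (fun i j => matvec U (L i j)); split=> [|iL a b|j k].
- split=> [i a b|j a b|i j k l ne /(matvec_proportional uU)].
  + by rewrite dot_matvec // rL.
  + by rewrite dot_matvec // cL.
  exact: dL.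
- by rewrite dot_matvec // iL.
by rewrite eq_sym -(rL x).
Qed.

Lemma has_imc_small (w : nat) : (w <= 1)%N -> has_imc w.
Proof.
move=> w1; have eqI (i j : 'I_w) : i = j.
  by apply: val_inj => /=; move: (ltn_ord i) (ltn_ord j); lia.
have ortho (i j : 'I_w) : dot (fun=> 1 : C) (fun _ : 'I_w => 1) = (i == j)%:R.
  rewrite (eqI i j) eqxx /dot (bigD1 j) //= rmorph1 mulr1 big1 ?addr0 // => k.
  by rewrite (eqI k j) eqxx.
exists (fun _ _ _ => 1); split=> //; split=> // i j k l.
by rewrite (eqI i k) (eqI j l) eqxx.
Qed.

Definition hadamard_array (n : nat) (H G : 'I_n -> 'I_n -> C) (i j k : 'I_n) : C :=
  (sqrtC n%:R)^-1 * (H i k * G j k).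

(** All entries have modulus one, so inner products along a row lose the factor [H i] and reduce to
    those of [G]; along a column they reduce to those of [H]. *)
Lemma hadamard_max_qls (n : nat) (H G : 'I_n -> 'I_n -> C) :
    (forall i k, (H i k)^* * H i k = 1) -> (forall j k, (G j k)^* * G j k = 1) ->
    (forall i i', i != i' -> dot (H i) (H i') = 0) ->
    (forall j j', j != j' -> dot (G j) (G j') = 0) ->
    (forall i j i' j', (i, j) != (i', j') ->
       ~ proportional (fun k => H i k * G j k) (fun k => H i' k * G j' k)) ->
  max_qls (hadamard_array H G) /\
  ((forall i i', i != i' -> dot (fun k => H i k * G i k) (fun k => H i' k * G i' k) = 0) ->
   orthonormal_diag (hadamard_array H G)).
Proof.
move=> H1 G1 HO GO dHG; set L := hadamard_array H G; pose r : C := (sqrtC n%:R)^-1.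
have n0 (i : 'I_n) : n%:R != 0 :> C.
  by rewrite pnatr_eq0 -lt0n (leq_ltn_trans _ (ltn_ord i)).
have r0 (i : 'I_n) : r != 0 by rewrite invr_neq0 // sqrtC_eq0 (n0 i).
have rr (i : 'I_n) : r^* * r * n%:R = 1.
  rewrite geC0_conj ?invr_ge0 ?sqrtC_ge0 ?ler0n // -expr2 exprVn sqrtCK mulVf //.
  exact: n0 i.
have dot_r u w : dot (fun k : 'I_n => r * u k) (fun k => r * w k) = r^* * r * dot u w.
  by rewrite /dot mulr_sumr; apply: eq_bigr => k _; rewrite rmorphM mulrACA.
have unit1 i j : dot (L i j) (L i j) = 1.
  rewrite dot_r -[RHS](rr i); congr (_ * _).
  rewrite /dot (eq_bigr (fun _ => 1)) ?sumr_const ?card_ord // => k _.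
  by rewrite rmorphM mulrACA H1 G1 mulr1.
split.
  split=> [i a b|j a b|i j k l ne [c e]].
  - have [<-|ab] := eqVneq a b; first exact: unit1.
    rewrite dot_r -[RHS](mulr0 (r^* * r)) -(GO a b ab); congr (_ * _).
    by apply: eq_bigr => k _; rewrite rmorphM mulrACA H1 mul1r.
  - have [<-|ab] := eqVneq a b; first exact: unit1.
    rewrite dot_r -[RHS](mulr0 (r^* * r)) -(HO a b ab); congr (_ * _).
    by apply: eq_bigr => k _; rewrite rmorphM mulrACA G1 mulr1.
  apply: dHG ne _; exists c => x.
  by apply: (mulfI (r0 x)); rewrite [LHS]e mulrCA.
move=> HG a b; have [<-|ab] := eqVneq a b; first exact: unit1.
by rewrite dot_r HG // mulr0.
Qed.

(** Modulo [n] the exponents run over all residues, which leaves a full geometric sum. *)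
Lemma sum_powers (n : nat) (z : C) (f : 'I_n -> nat) :
    z ^+ n = 1 -> z != 1 -> injective (fun k => f k %% n)%N ->
  \sum_k z ^+ f k = 0.
Proof.
move=> zn z1 inj_f; case: n => [|n] in f zn inj_f *; first by rewrite big_ord0.
have inj_g : injective (fun k => inord (f k %% n.+1) : 'I_n.+1).
  by move=> k l /(congr1 val); rewrite /= !inordK ?ltn_pmod //; apply: inj_f.
transitivity (\sum_(k < n.+1) z ^+ k).
  rewrite [RHS](reindex_inj inj_g); apply: eq_bigr => k _.
  by rewrite /= inordK ?ltn_pmod // expr_mod.
by apply/eqP; have /eqP := subrX1 z n.+1; rewrite zn subrr eq_sym mulf_eq0 subr_eq0 (negPf z1).
Qed.

Lemma exists_prim_root (n : nat) : (0 < n)%N ->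
  exists2 w : C, n.-primitive_root w & w^* = w^-1.
Proof.
move=> n_gt0; pose p : {poly C} := 'X^n - 1.
have [r Dp] := closed_field_poly_normal p.
rewrite (monicP _) ?monicXnsubC // scale1r in Dp.
have rn1 : all n.-unity_root r by apply/allP=> z; rewrite -root_prod_XsubC -Dp.
have sz_r : (n < (size r).+1)%N by rewrite -(size_prod_XsubC r id) -Dp size_XnsubC.
have [|w] := hasP (has_prim_root n_gt0 rn1 _ sz_r).
  by rewrite -separable_prod_XsubC -Dp separable_Xn_sub_1 // pnatr_eq0 -lt0n.
move=> _ wP; exists w => //; rewrite invC_norm.
have /eqP-> : `|w| == 1.
  by rewrite -(@pexpr_eq1 _ _ n) // -normrX (prim_expr_order wP) normr1.
by rewrite expr1n invr1 mul1r.
Qed.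

(* With [w] a primitive n-th root of unity, [H = (w^(i p k))] and
   [G = (w^(- j k))]; the diagonal of the array is then again a Hadamard matrix
   as soon as [k |-> p k - k] is a permutation of Z/n. *)
Lemma cyclic_max_qls (n : nat) (p : 'I_n -> nat) :
    injective (fun k => p k %% n)%N ->
    (exists2 k : 'I_n, p k = 0%N & k = 0%N :> nat) ->
    (forall x y : C, x ^+ n = 1 -> y ^+ n = 1 ->
       (forall k : 'I_n, x ^+ p k * y ^+ k = 1) -> x = 1 /\ y = 1) ->
  exists2 L : 'I_n -> 'I_n -> 'I_n -> C, max_qls L &
    injective (fun k : 'I_n => (p k + (n - k)) %% n)%N -> orthonormal_diag L.
Proof.
move=> inj_p [o po o0] nondeg.
have n0 : (0 < n)%N by apply: leq_ltn_trans (ltn_ord o).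
have [w wP wN] := exists_prim_root n0.
have wn d : w ^+ d ^+ n = 1 by rewrite exprAC (prim_expr_order wP) expr1n.
have w0 d : w ^+ d != 0.
  by rewrite expf_neq0 // (prim_root_eq0 wP) -lt0n.
have wNX d : (w ^+ d)^* = (w ^+ d)^-1 by rewrite rmorphXn /= wN exprVn.
pose z (i i' : 'I_n) : C := w ^+ i' / w ^+ i.
have zn i i' : z i i' ^+ n = 1 by rewrite expr_div_n !wn divr1.
have z1 i i' : z i i' = 1 -> i = i'.
  move/divr1_eq/eqP; rewrite (eq_prim_root_expr wP) !modn_small // => /eqP e.
  exact/esym/val_inj.
have zK (i i' : 'I_n) (e : nat) : (w ^+ (i * e))^* * w ^+ (i' * e) = z i i' ^+ e.
  by rewrite wNX mulrC expr_div_n -!exprM.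
have zK' (i i' : 'I_n) (e : nat) : w ^+ (i * e) * (w ^+ (i' * e))^* = z i' i ^+ e.
  by rewrite wNX expr_div_n -!exprM.
have unit1 d : (w ^+ d)^* * w ^+ d = 1 by rewrite wNX mulVf.
have [|||||mL iL] := @hadamard_max_qls n
    (fun i k => w ^+ (i * p k)) (fun j k => (w ^+ (j * k))^*).
- by [].
- by move=> j k; rewrite conjCK mulrC unit1.
- move=> i i' ii'; rewrite /dot; under eq_bigr => k _ do rewrite zK.
  by apply: sum_powers => //; apply: contraNneq ii' => /z1->.
- move=> i i' ii'; rewrite /dot; under eq_bigr => k _ do rewrite conjCK zK'.
  apply: sum_powers => //; first by apply: contraNneq ii' => /z1->.
  by move=> k l; rewrite !modn_small // => /val_inj.
- move=> i j i' j' + [c e].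
  (* Both exponents vanish at coordinate [o], where the two vectors have entry 1. *)
  have c1 : c = 1.
    by have := e o; rewrite po o0 !muln0 rmorph1 !mulr1 => <-.
  have [k| /z1 <- /z1 <-] := nondeg (z i' i) (z j j') (zn _ _) (zn _ _); last first.
    by rewrite eqxx.
  have := e k; rewrite c1 mul1r !wNX => {}e.
  rewrite !expr_div_n -!exprM [_ ^+ (j' * k) / _]mulrC mulrACA e.
  by rewrite mulrACA mulfV // mulVf // mulr1.
exists (hadamard_array (fun i k => w ^+ (i * p k)) (fun j k => (w ^+ (j * k))^*)) => //.
move=> inj_d; apply: iL => i i' ii'; rewrite /dot.
rewrite (eq_bigr (fun k : 'I_n => z i i' ^+ (p k + (n - k)))).
  by apply: sum_powers => //; apply: contraNneq ii' => /z1->.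
move=> k _; rewrite rmorphM /= mulrACA zK conjCK zK' exprD exprB ?(ltnW (ltn_ord k)) //.
  by rewrite zn mul1r -exprVn invf_div.
by rewrite unitfE mulf_neq0 ?invr_neq0.
Qed.

End Squares.

(** * Existence of squares from finite checks on exponents *)

Section Certificates.
Variable C : numClosedFieldType.

(** Exchanging 1 and 2 is far enough from affine: exponents 3 and 4 give [x y = 1] (for [n = 4] the
    latter comes from [x^n = y^n = 1]), and coordinate 1 gives [x^2 y = 1]. *)
Lemma has_mc_ge4 (n : nat) : (4 <= n)%N -> has_mc C n.
Proof.
move=> n4; pose p (k : 'I_n) := (if k == 1 :> nat then 2 else if k == 2 :> nat then 1 else k)%N.
have [||x y xn yn e|L mL _] := @cyclic_max_qls C n p; last by exists L.
- have pn k : (p k < n)%N by rewrite /p; move: (ltn_ord k); do 2?case: ifP; lia.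
  move=> k l; rewrite !modn_small // /p => e; apply: val_inj => /=.
  by move: e; do 4?case: eqP; lia.
- by exists (Ordinal (ltnW (ltnW (ltnW n4)))).
have xy k : (2 < k <= n)%N -> (x * y) ^+ k = 1.
  case/andP=> k2; rewrite leq_eqVlt => /predU1P[->|kn]; first by rewrite exprMn xn yn mulr1.
  by have := e (Ordinal kn); rewrite /p /= !ifN ?exprMn //; lia.
have xy1 : x * y = 1.
  by have := xy 4%N n4; rewrite exprSr xy ?mul1r // (ltnW n4).
have x1 : x = 1.
  have := e (Ordinal (ltnW (ltnW n4))); rewrite /p /= expr2 expr1 -mulrA xy1 mulr1.
  by [].
by split=> //; move: xy1; rewrite x1 mul1r.
Qed.

(* The truncated difference is a 2 x 2 minor of the graph of [s]; its coprimality
   with [n] shows that no nontrivial combination of [s a] and [a] is constant. *)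
Definition cyclic_certificate (n : nat) (s : seq nat) (k l : nat) : bool :=
  [&& nth 0 s 0 == 0, uniq [seq nth 0 s a %% n | a <- iota 0 n],
      uniq [seq (nth 0 s a + (n - a)) %% n | a <- iota 0 n], k < n, l < n
    & coprime n (nth 0 s l * k - nth 0 s k * l)]%N.

Lemma cyclic_has_imc (n : nat) (s : seq nat) (k l : nat) :
  cyclic_certificate n s k l -> has_imc C n.
Proof.
case/and5P => /eqP s0 us ud kn /andP[ln co].
have ord_inj f : uniq [seq (f a %% n)%N | a <- iota 0 n] ->
    injective (fun a : 'I_n => f a %% n)%N.
  move/(mkseq_uniqP (fun a => f a %% n)%N) => inj_f a b e.
  by apply: val_inj; apply: inj_f; rewrite ?inE ?ltn_ord.
have [||x y xn yn e|L mL iL] := @cyclic_max_qls C n (fun a => nth 0%N s a).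
- exact: ord_inj us.
- by exists (Ordinal (leq_ltn_trans (leq0n k) kn)).
- have n_gt0 : (0 < n)%N by apply: leq_ltn_trans kn.
  have neq0 t : t ^+ n = 1 -> t != 0 :> C.
    move=> tn; have : t ^+ n != 0 by rewrite tn oner_neq0.
    by rewrite expf_eq0 n_gt0.
  have one t d : t ^+ n = 1 -> t ^+ d = 1 -> coprime n d -> t = 1 :> C.
    move=> tn td /eqP co_nd; case: (egcdnP d n_gt0) => a b def_a _.
    have := congr1 (fun r => t ^+ r) def_a.
    by rewrite /= co_nd exprD expr1 !(mulnC _ n, mulnC _ d) !exprM tn td !expr1n mul1r.
  have [ek el] := (e (Ordinal kn), e (Ordinal ln)); rewrite /= in ek el.
  have sub t a b : t ^+ n = 1 -> t ^+ a = t ^+ b -> t ^+ (a - b) = 1 :> C.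
    move=> tn tab; have [lt|] := ltnP b a; last by rewrite -subn_eq0 => /eqP->.
    apply: (mulIf (expf_neq0 b (neq0 t tn))).
    by rewrite -exprD subnK ?mul1r // ltnW.
  (* The [l]-th power of the relation at [k] and the [k]-th power of that at [l] eliminate [y],
     leaving the minor as an exponent of [x]. *)
  have x1 : x = 1.
    apply: one co => //; apply: sub => //.
    apply: (mulIf (expf_neq0 (k * l) (neq0 y yn))).
    by rewrite {1}(mulnC k l) !exprM -!exprMn ek el !expr1n.
  split=> //; apply: one co => //; apply: sub => //.
  move: ek el; rewrite x1 !expr1n !mul1r => yk yl.
  by rewrite !(mulnC _ k, mulnC _ l) !exprM yk yl !expr1n.
exists L; split=> //; exact: iL (ord_inj _ ud).
Qed.

(* For a prime [q], both [k |-> p k] and [k |-> p k - k] are permutations as soon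
   as [a * b] and [(a - 1) * (b - 1)] are nonzero squares modulo [q]. *)
Definition quadratic_orthomorphism (q a b : nat) : seq nat :=
  let squares := [seq x * x %% q | x <- iota 1 q.-1]%N in
  [seq (if x \in squares then a else b) * x %% q | x <- iota 0 q]%N.

(* Invariance under a nontrivial shift forces the sum of the corresponding powers
   of an N-th root of unity to vanish. *)
Definition balanced (N : nat) (s : seq nat) : bool :=
  has (fun r => perm_eq [seq x %% N | x <- s] [seq (x + r) %% N | x <- s])%N
    (iota 1 N.-1).

(* The exponent of the conjugate of [w^e] is [N.-1 * e]. *)
Definition exponent_hadamard (N n : nat) (h : nat -> nat -> nat) : bool :=
  all (fun i => all (fun j => (i == j) ||
    balanced N [seq N.-1 * h i k + h j k | k <- iota 0 n]) (iota 0 n)) (iota 0 n)%N.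

(* The exponents of the vector [(i, j)] once its coordinate 0 is scaled to 1. *)
Definition projective_exponents (N n : nat) (h g : nat -> nat -> nat) (i j : nat) :=
  [seq (h i k + g j k + N.-1 * (h i 0 + g j 0)) %% N | k <- iota 0 n]%N.

Definition exponent_certificate (N n : nat) (h g : nat -> nat -> nat) : bool :=
  [&& (0 < N)%N, exponent_hadamard N n h, exponent_hadamard N n g,
      exponent_hadamard N n (fun i k => h i k + g i k)%N
    & uniq [seq projective_exponents N n h g (x %/ n) (x %% n) | x <- iota 0 (n * n)]]%N.

(** Powers of [w] are compared through exponents modulo [N], which turns orthogonality and
    distinctness up to a scalar into finite checks. *)
Lemma exponent_has_imc (N n : nat) (h g : nat -> nat -> nat) :
  exponent_certificate N n h g -> has_imc C n.
Proof.
case/and5P => N0 hH gH hgH uP; have [w wP wN] := exists_prim_root C N0.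
have wmod e : w ^+ (e %% N) = w ^+ e by rewrite (prim_expr_mod wP).
have wNN : w ^+ N = 1 := prim_expr_order wP.
have w0 d : w ^+ d != 0 by rewrite expf_neq0 // (prim_root_eq0 wP) -lt0n.
have wNX d : (w ^+ d)^* = w ^+ (N.-1 * d).
  rewrite rmorphXn /= wN exprM; congr (_ ^+ _); apply: (mulfI (w0 1%N)).
  by rewrite expr1 mulfV ?(w0 1%N) // -exprS prednK.
have balanced_sum s : balanced N s -> \sum_(e <- s) w ^+ e = 0.
  case/hasP => r; rewrite mem_iota => /andP[r0 rN] pr.
  have := perm_big _ pr (op := +%R) (x := 0) (P := xpredT) (F := fun e => w ^+ e).
  rewrite !big_map; under eq_bigr => e _ do rewrite wmod.
  under [X in _ = X]eq_bigr => e _ do rewrite wmod exprD.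
  rewrite -mulr_suml => /eqP; rewrite -subr_eq0 -{1}[\sum_(_ <- _) _]mulr1 -mulrBr mulf_eq0.
  case/orP => [/eqP//|]; rewrite subr_eq0 eq_sym -(prim_order_dvd wP) gtnNdvd //.
  by move: rN; rewrite add1n prednK.
have ortho f : exponent_hadamard N n f -> forall i i' : 'I_n, i != i' ->
    dot (fun k : 'I_n => w ^+ f i k) (fun k => w ^+ f i' k) = 0.
  move=> /allP fH i i' ii'.
  have in_iota (a : 'I_n) : (a : nat) \in iota 0 n by rewrite mem_iota ltn_ord.
  have /allP/(_ i' (in_iota i')) := fH i (in_iota i).
  rewrite (inj_eq val_inj) (negPf ii') /= => /balanced_sum <-.
  have -> : iota 0 n = index_iota 0 n by rewrite /index_iota subn0.
  rewrite big_map big_mkord; apply: eq_bigr => k _.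
  by rewrite wNX exprD.
have unit1 d : (w ^+ d)^* * w ^+ d = 1.
  by rewrite wNX -exprD addnC -mulSn prednK // exprM wNN expr1n.
have [|||||mL iL] := @hadamard_max_qls C n
    (fun i k => w ^+ h i k) (fun j k => w ^+ g j k) => //.
- exact: ortho hH.
- exact: ortho gH.
- move=> i j i' j' ne [c e].
  have n0 : (0 < n)%N by apply: leq_ltn_trans (ltn_ord i).
  have wV d : w ^+ (N.-1 * d) = (w ^+ d)^-1 by rewrite -wNX rmorphXn /= wN exprVn.
  have c0 : c != 0.
    by apply/eqP => c0; move/eqP: (e i); rewrite c0 mul0r mulf_eq0 !(negPf (w0 _)).
  have ee : projective_exponents N n h g i j = projective_exponents N n h g i' j'.
    apply/eq_in_map => k; rewrite mem_iota /= add0n => kn.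
    apply/eqP; rewrite -(eq_prim_root_expr wP); apply/eqP.
    rewrite 2!exprD wV exprD (e (Ordinal kn)) (e (Ordinal n0)) /=.
    by rewrite -mulf_div divff // mul1r !exprD wV exprD.
  have pair_lt (a b : 'I_n) : (a * n + b \in gtn (n * n))%N.
    by rewrite inE; move: (ltn_ord a) (ltn_ord b); nia.
  have/mkseq_uniqP/(_ _ _ (pair_lt i j) (pair_lt i' j')) := uP.
  rewrite !divnMDl // !modnMDl !divn_small // !modn_small // !addn0 => /(_ ee) eij.
  have := congr1 (divn^~ n) eij; have := congr1 (modn^~ n) eij.
  rewrite /= !modnMDl !divnMDl // !divn_small // !modn_small // !addn0.
  by move=> /val_inj ej /val_inj ei; rewrite ei ej eqxx in ne.
exists (hadamard_array (fun i k : 'I_n => w ^+ h i k) (fun j k => w ^+ g j k)).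
split=> //; apply: iL => i i' ii'; rewrite -[RHS](ortho _ hgH i i' ii').
by apply: eq_dot => k; rewrite exprD.
Qed.
End Certificates.

(* With [i = 4 i1 + i2], the exponent of [sqrt (-1)] in the characters of
   Z/4 x Z/4 for [c = 1], and of Z/2 x Z/4 for [c = 2]. *)
Definition block_pairing (c i k : nat) : nat :=
  (c * (i %/ 4) * (k %/ 4) + (i %% 4) * (k %% 4)) %% 4.

(** * Idempotent squares of small order *)

Section Base.
Variable C : numClosedFieldType.

(** On a cyclic group of even order [p] and [k |-> p k - k] cannot both be permutations, hence a
    noncyclic group. Here [t] also reorders the characters of the second matrix. *)
Lemma has_imc8 : has_imc C 8.
Proof.
pose p := [:: 0; 1; 7; 2; 4; 5; 3; 6]%N; pose t := [:: 0; 4; 2; 6; 3; 5; 1; 7]%N.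
apply: (@exponent_has_imc C 4 8 (block_pairing 2)
  (fun i k => block_pairing 2 (nth 0%N t i) (nth 0%N p k))).
by vm_compute.
Qed.

(** The cyclic construction carried over to Z/4 x Z/4; the factor 3 conjugates the characters. *)
Lemma has_imc16 : has_imc C 16.
Proof.
pose p := [:: 0; 2; 1; 4; 3; 8; 12; 15; 5; 11; 14; 13; 7; 6; 10; 9]%N.
apply: (@exponent_has_imc C 4 16 (fun i k => block_pairing 1 i (nth 0%N p k))
  (fun i k => 3 * block_pairing 1 i k)%N).
by vm_compute.
Qed.
Lemma has_imc9 : has_imc C 9.
Proof.
by apply: (@cyclic_has_imc C 9 [:: 0; 2; 1; 6; 8; 7; 4; 3; 5]%N 2 6); vm_compute.
Qed.

Lemma has_imc15 : has_imc C 15.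
Proof.
apply: (@cyclic_has_imc C 15
  [:: 0; 2; 1; 5; 7; 9; 12; 14; 13; 3; 6; 4; 10; 8; 11]%N 2 3).
by vm_compute.
Qed.

(** An entry [(q, a, b, k, l)] holds a prime, the multipliers on nonzero squares and elsewhere, and
    the two positions of the minor. *)
Definition quadratic_certificates : seq (nat * nat * nat * nat * nat) :=
  [:: (7, 3, 5, 3, 1); (11, 2, 6, 2, 1); (13, 2, 5, 1, 2); (17, 2, 9, 1, 3);
      (23, 2, 3, 1, 5); (29, 2, 8, 1, 2); (47, 2, 3, 1, 5); (53, 2, 5, 1, 2);
      (59, 2, 6, 1, 2); (83, 2, 5, 1, 2)]%N.

Lemma has_imc_prime (q : nat) :
  q \in [seq x.1.1.1.1 | x <- quadratic_certificates] -> has_imc C q.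
Proof.
have : all (fun x => let: (q, a, b, k, l) := x in
    cyclic_certificate q (quadratic_orthomorphism q a b) k l) quadratic_certificates.
  by vm_compute.
by move=> /allP ok /mapP[[[[[q' a] b] k] l] /ok /= cert ->]; apply: cyclic_has_imc cert.
Qed.
End Base.

(** * Composition along a Latin square *)

Lemma big_option (R : nmodType) (T : finType) (F : option T -> R) :
  \sum_x F x = F None + \sum_k F (Some k).
Proof.
rewrite (bigD1 None) //=; congr (_ + _).
rewrite (reindex_omap Some id) /=; last by case.
by apply: eq_bigl => k; rewrite eqxx.
Qed.

Section Composition.
Variables (C : numClosedFieldType) (M W : finType) (n : nat).
Local Notation N := 'I_n.
Local Notation point := (M * N + W)%type.

(* The basis vectors are [inl (c, k)], the k-th one of the block c of symbols, and
   [inr t], shared by the cells of the transversal [t]; [tag a b] is the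
   transversal through the cell (a, b), which meets row a in column [cb t a] and
   column b in row [ca t b].  The index [None] stands for the extra row, column
   and coordinate of an ingredient of order n + 1. *)
Definition cell_vector (A : M -> M -> M) (tag : M -> M -> option W)
    (U : M -> M -> N -> N -> C) (Q : M -> M -> option N -> option N -> option N -> C)
    (a b : M) (i j : option N) (x : point) : C :=
  match x with
  | inl (c, k) =>
      if c == A a b then matvec (U a b) (fun l => Q a b i j (Some l)) k else 0
  | inr t => if tag a b == Some t then Q a b i j None else 0
  end.

Definition composed_array A tag U Q (ca cb : W -> M -> M) (K : W -> W -> W -> C)
    (x y : point) : point -> C :=
  match x, y with
  | inl (a, i), inl (b, j) => cell_vector A tag U Q a b (Some i) (Some j)
  | inl (a, i), inr t => cell_vector A tag U Q a (cb t a) (Some i) None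
  | inr t, inl (b, j) => cell_vector A tag U Q (ca t b) b None (Some j)
  | inr t, inr s => fun z => if z is inr r then K t s r else 0
  end.

(** The index [None] exists only in a tagged cell, whose ingredient has order n + 1. *)
Definition valid (tag : M -> M -> option W) a b (i : option N) : bool :=
  isSome (tag a b) || isSome i.

Lemma dot_point (u w : point -> C) :
  dot u w = \sum_c dot (fun k => u (inl (c, k))) (fun k => w (inl (c, k)))
          + dot (fun t => u (inr t)) (fun t => w (inr t)).
Proof.
by rewrite /dot big_sumType pair_bigA; congr (_ + _); apply: eq_bigr => -[c k].
Qed.

(** Cells with different symbols overlap at most in the coordinate of a common transversal. *)
Lemma dot_cell_disjoint A tag U Q a b i j a' b' i' j' :
    A a b != A a' b' -> (forall t, tag a b = Some t -> tag a' b' = Some t ->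
      Q a b i j None = 0) ->
  dot (cell_vector A tag U Q a b i j) (cell_vector A tag U Q a' b' i' j') = 0.
Proof.
move=> neA notag; rewrite dot_point [X in _ + X]big1 => [|t _]; last first.
  rewrite /cell_vector; have [e|_] := eqVneq (tag a b) _; last by rewrite rmorph0 mul0r.
  have [e'|_] := eqVneq (tag a' b') _; last by rewrite mulr0.
  by rewrite (notag t e e') rmorph0 mul0r.
rewrite addr0 big1 // => c _; apply: big1 => k _; rewrite /cell_vector.
have [->|_] := eqVneq c (A a b); first by rewrite (negPf neA) mulr0.
by rewrite rmorph0 mul0r.
Qed.

(** * Orthonormality of the rows of the composed array *)

Section Rows.
Variables (A : M -> M -> M) (tag : M -> M -> option W).
Variables (U : M -> M -> N -> N -> C) (Q : M -> M -> option N -> option N -> option N -> C).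
Variables (ca cb : W -> M -> M) (K : W -> W -> W -> C).
Hypothesis uU : forall a b, unitary_op (U a b).
Hypothesis A_row : forall a, injective (A a).
Hypothesis tag_ca : forall t a b, (tag a b == Some t) = (a == ca t b).
Hypothesis tag_cb : forall t a b, (tag a b == Some t) = (b == cb t a).
Hypothesis A_tag : forall t, injective (fun b => A (ca t b) b).
Hypothesis Q_row : forall a b i j j', valid tag a b i -> valid tag a b j ->
  valid tag a b j' -> dot (Q a b i j) (Q a b i j') = (j == j')%:R.
Hypothesis Q_untagged : forall a b i j, tag a b = None -> Q a b i j None = 0.
Hypothesis Q_corner : forall a b k, isSome (tag a b) -> Q a b None None k = (k == None)%:R.
Hypothesis K_row : forall t, orthonormal_family (K t).

Lemma dot_cell_same a b i j i' j' :
  dot (cell_vector A tag U Q a b i j) (cell_vector A tag U Q a b i' j') =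
  dot (Q a b i j) (Q a b i' j').
Proof.
rewrite dot_point [RHS]/dot big_option addrC; congr (_ + _).
  rewrite (bigD1 (A a b)) //= big1 ?addr0 => [|c /negPf cA].
    by rewrite eqxx dot_matvec.
  by rewrite /dot big1 // => k _; rewrite cA rmorph0 mul0r.
case e : (tag a b) => [t|].
  rewrite /dot (bigD1 t) //= !e eqxx big1 ?addr0 // => s /negPf st.
  by rewrite (inj_eq Some_inj) eq_sym st rmorph0 mul0r.
rewrite /dot big1 => [|t _]; last by rewrite /= e rmorph0 mul0r.
by rewrite Q_untagged // rmorph0 mul0r.
Qed.

Lemma composed_array_rows x :
  orthonormal_family (composed_array A tag U Q ca cb K x).
Proof.
case: x => [[a i]|t].
  pose col (y : point) := match y with inl (b, _) => b | inr s => cb s a end.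
  pose idx (y : point) := match y with inl (_, j) => Some j | inr _ => None end.
  have cellE y : composed_array A tag U Q ca cb K (inl (a, i)) y =
      cell_vector A tag U Q a (col y) (Some i) (idx y) by case: y => [[]|].
  have vy y : valid tag a (col y) (idx y).
    case: y => [[b j]|s]; first by rewrite /valid orbT.
    by rewrite /valid /= orbF; have /eqP-> : tag a (cb s a) == Some s by rewrite tag_cb.
  move=> y y'; rewrite !cellE; have [e|ne] := eqVneq (col y) (col y').
    rewrite e dot_cell_same Q_row // -?e // ?[in X in valid _ _ X]e //; last exact: orbT.
    congr (_%:R); move: e; case: y y' => [[b j]|s] [[b' j']|s'] //= e.
      by rewrite e !(inj_eq Some_inj, inj_eq inl_inj) xpair_eqE eqxx.
    have := tag_cb s a (cb s a); rewrite eqxx e => /eqP s1.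
    have := tag_cb s' a (cb s' a); rewrite eqxx => /eqP; rewrite s1 => -[->].
    by rewrite !eqxx.
  rewrite dot_cell_disjoint ?(inj_eq (@A_row a)) //.
    by case: (y =P y') ne => [->|//]; rewrite eqxx.
  by move=> t /eqP; rewrite tag_cb => /eqP e /eqP; rewrite tag_cb -e eq_sym (negPf ne).
have tS b : isSome (tag (ca t b) b).
  by have /eqP-> : tag (ca t b) b == Some t by rewrite tag_ca.
(* The corner entry is the coordinate vector [None], so the rest of its row has no component along
   the shared vector. *)
have Q0 b j : Q (ca t b) b None (Some j) None = 0.
  rewrite -(dot_unit None).
  transitivity (dot (Q (ca t b) b None None) (Q (ca t b) b None (Some j))).
    by apply: eq_dot => // k; rewrite Q_corner.
  by rewrite Q_row // /valid tS.
have corner0 b j s : dot (composed_array A tag U Q ca cb K (inr t) (inr s))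
    (composed_array A tag U Q ca cb K (inr t) (inl (b, j))) = 0.
  rewrite dot_point big1 => [|c _]; last by apply: big1 => k _; rewrite rmorph0 mul0r.
  by rewrite add0r; apply: big1 => r _ /=; rewrite Q0 if_same mulr0.
case=> [[b j]|s] [[b' j']|s'].
- rewrite (inj_eq inl_inj) xpair_eqE /=; have [->|ne] := eqVneq b b'.
    by rewrite dot_cell_same Q_row ?/valid ?tS.
  rewrite dot_cell_disjoint //; first by apply: contraNneq ne => /A_tag->.
- by rewrite -dot_conj corner0 rmorph0.
- by rewrite corner0.
rewrite (inj_eq inr_inj) -(K_row t) dot_point big1 ?add0r // => c _.
by apply: big1 => k _; rewrite rmorph0 mul0r.
Qed.
End Rows.

(* Exchanging rows and columns turns a composed array into another one. *)
Lemma composed_array_cols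
    (A : M -> M -> M) (tag : M -> M -> option W)
    (U : M -> M -> N -> N -> C) (Q : M -> M -> option N -> option N -> option N -> C)
    (ca cb : W -> M -> M) (K : W -> W -> W -> C) :
    (forall a b, unitary_op (U a b)) ->
    (forall b, injective (A^~ b)) ->
    (forall t a b, (tag a b == Some t) = (a == ca t b)) ->
    (forall t a b, (tag a b == Some t) = (b == cb t a)) ->
    (forall t, injective (fun a => A a (cb t a))) ->
    (forall a b i i' j, valid tag a b i -> valid tag a b i' -> valid tag a b j ->
       dot (Q a b i j) (Q a b i' j) = (i == i')%:R) ->
    (forall a b i j, tag a b = None -> Q a b i j None = 0) ->
    (forall a b k, isSome (tag a b) -> Q a b None None k = (k == None)%:R) ->
    (forall t, orthonormal_family (K^~ t)) ->
  forall y, orthonormal_family (fun x => composed_array A tag U Q ca cb K x y).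
Proof.
move=> uU A_col tag_ca tag_cb A_tag Q_col Q_un Q_co K_col y x x'.
rewrite -(@composed_array_rows (fun a b => A b a) (fun a b => tag b a)
  (fun a b => U b a) (fun a b i j => Q b a j i) cb ca (fun t s => K s t)
  _ _ _ _ _ _ _ _ _ y x x') //.
- by apply: eq_dot; case: x x' y => [[? ?]|?] [[? ?]|?] [[? ?]|?].
- by move=> a b i j j' vi vj vj'; apply: Q_col.
- by move=> a b i j; apply: Q_un.
- by move=> a b; apply: Q_co.
Qed.

(** Only the block part is rotated by [U], so genericity can separate only vectors whose block part
    is nonzero. *)
Definition nonzero_on_block (q : option N -> C) : Prop := exists l, q (Some l) != 0.

(** * Pairwise distinctness of the entries of the composed array *)

Section Distinctness.
Variables (A : M -> M -> M) (tag : M -> M -> option W).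
Variables (U : M -> M -> N -> N -> C) (Q : M -> M -> option N -> option N -> option N -> C).
Variables (ca cb : W -> M -> M) (K : W -> W -> W -> C).
Hypothesis uU : forall a b, unitary_op (U a b).
Hypothesis tag_ca : forall t a b, (tag a b == Some t) = (a == ca t b).
Hypothesis tag_cb : forall t a b, (tag a b == Some t) = (b == cb t a).
Hypothesis U_generic : forall a b i j a' b' i' j', (a, b) != (a', b') ->
  nonzero_on_block (Q a b i j) -> nonzero_on_block (Q a' b' i' j') ->
  ~ proportional (matvec (U a b) (fun l => Q a b i j (Some l)))
                 (matvec (U a' b') (fun l => Q a' b' i' j' (Some l))).
Hypothesis Q_distinct : forall a b i j i' j', valid tag a b i -> valid tag a b j ->
  valid tag a b i' -> valid tag a b j' -> (i, j) != (i', j') ->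
  ~ proportional (Q a b i j) (Q a b i' j').
Hypothesis Q_nonzero : forall a b i j, valid tag a b i -> valid tag a b j ->
  (i, j) != (None, None) -> nonzero_on_block (Q a b i j).
Hypothesis Q_untagged : forall a b i j, tag a b = None -> Q a b i j None = 0.
Hypothesis K_row : forall t, orthonormal_family (K t).
Hypothesis K_distinct : forall i j k l, (i, j) != (k, l) -> ~ proportional (K i j) (K k l).

Definition cell_of (x y : point) : option (M * M * (option N * option N)) :=
  match x, y with
  | inl (a, i), inl (b, j) => Some (a, b, (Some i, Some j))
  | inl (a, i), inr t => Some (a, cb t a, (Some i, None))
  | inr t, inl (b, j) => Some (ca t b, b, (None, Some j))
  | inr t, inr s => None
  end.

Lemma tag_at_cb t a : tag a (cb t a) = Some t.
Proof. by apply/eqP; rewrite tag_cb. Qed.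

Lemma tag_at_ca t b : tag (ca t b) b = Some t.
Proof. by apply/eqP; rewrite tag_ca. Qed.

Lemma cell_of_vector x y a b i j : cell_of x y = Some (a, b, (i, j)) ->
  [/\ composed_array A tag U Q ca cb K x y = cell_vector A tag U Q a b i j,
      valid tag a b i, valid tag a b j & (i, j) != (None, None)].
Proof.
rewrite /valid; case: x y => [[a1 i1]|t] [[b1 j1]|s] //= [<- <- <- <-].
- by rewrite !orbT.
- by rewrite orbT tag_at_cb.
by rewrite orbT tag_at_ca.
Qed.

Lemma cell_of_inj x y x' y' :
  cell_of x y = cell_of x' y' -> cell_of x y != None -> (x, y) = (x', y').
Proof.
case: x y x' y' => [[a i]|t] [[b j]|s] [[a' i']|t'] [[b' j']|s'] //= [].
- by move=> -> -> -> ->.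
- by move=> -> e ->; have := tag_at_cb s a'; rewrite e tag_at_cb => -[->].
by move=> e eb -> _; rewrite eb in e *; have := tag_at_ca t b'; rewrite e tag_at_ca => -[->].
Qed.

Lemma cell_vector_neq0 a b i j : nonzero_on_block (Q a b i j) ->
  exists k, cell_vector A tag U Q a b i j (inl (A a b, k)) != 0.
Proof.
case=> l ql; apply/existsP; apply: contraNT ql; rewrite negb_exists => /forallP q0.
apply/eqP; move: l; apply: (matvec_inj (uU a b)) => k.
have := q0 k; rewrite /= eqxx negbK => /eqP->.
by rewrite /matvec big1 // => l _; rewrite mulr0.
Qed.

(** The support reveals the symbol; different cells with one symbol are separated by the generic
    unitaries; within a cell the unitary is undone and the ingredient decides. *)
Lemma cell_vector_distinct a b i j a' b' i' j' :
    valid tag a b i -> valid tag a b j -> valid tag a' b' i' -> valid tag a' b' j' ->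
    (i, j) != (None, None) -> (i', j') != (None, None) ->
    (a, b, (i, j)) != (a', b', (i', j')) ->
  ~ proportional (cell_vector A tag U Q a b i j) (cell_vector A tag U Q a' b' i' j').
Proof.
move=> vi vj vi' vj' ij ij' ne [c e].
have nz := Q_nonzero vi vj ij; have nz' := Q_nonzero vi' vj' ij'.
have eA : A a b = A a' b'.
  have [k] := cell_vector_neq0 nz; rewrite e /=; case: (A a b =P A a' b') => // _.
  by rewrite mulr0 eqxx.
have block k : matvec (U a b) (fun l => Q a b i j (Some l)) k =
    c * matvec (U a' b') (fun l => Q a' b' i' j' (Some l)) k.
  by have := e (inl (A a b, k)); rewrite /= eA !eqxx.
have [eab|neab] := eqVneq (a, b) (a', b'); last first.
  by apply: (U_generic neab nz nz'); exists c.
case: eab => ? ?; subst a' b'; apply: (Q_distinct vi vj vi' vj').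
  by apply: contraNneq ne => ->.
exists c; case=> [l|].
  move: l; apply: (matvec_inj (uU a b)) => k; rewrite block.
  by apply/esym/matvec_scale.
case et : (tag a b) => [t|]; last by rewrite !Q_untagged // mulr0.
by have := e (inr t); rewrite /= et eqxx.
Qed.

Lemma corner_neq0 t s : exists r, K t s r != 0.
Proof.
apply/existsP; apply: contraT; rewrite negb_exists => /forallP K0.
have /eqP := K_row t s s; rewrite eqxx /dot big1 ?(eq_sym 0) ?oner_eq0 // => r _.
by have := K0 r; rewrite negbK => /eqP->; rewrite mulr0.
Qed.

Lemma composed_array_distinct x y x' y' : (x, y) != (x', y') ->
  ~ proportional (composed_array A tag U Q ca cb K x y)
                 (composed_array A tag U Q ca cb K x' y').
Proof.
move=> ne; case e : (cell_of x y) => [[[a b] [i j]]|];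
  case e' : (cell_of x' y') => [[[a' b'] [i' j']]|].
- have [-> vi vj ij] := cell_of_vector e; have [-> vi' vj' ij'] := cell_of_vector e'.
  apply: cell_vector_distinct => //; apply: contraNneq ne => ee.
  by apply/eqP; apply: cell_of_inj; rewrite e ?e' ?ee.
- have [-> vi vj ij] := cell_of_vector e; case: x' y' e' {ne} => [[? ?]|t] [[? ?]|s] //= _ [c ec].
  have [k] := cell_vector_neq0 (Q_nonzero vi vj ij).
  by rewrite ec mulr0 eqxx.
(* A corner vector vanishes on all blocks, so here the scalar must be 0, and the corner vector would
   be zero. *)
- have [-> vi vj ij] := cell_of_vector e'; case: x y e {ne} => [[? ?]|t] [[? ?]|s] //= _ [c ec].
  have [k ck] := cell_vector_neq0 (Q_nonzero vi vj ij).
  have [r] := corner_neq0 t s; have := ec (inr r) => /= ->.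
  have /esym/eqP := ec (inl (A a' b', k)); rewrite /= in ck *; rewrite mulf_eq0 (negPf ck) orbF.
  by move/eqP->; rewrite mul0r eqxx.
case: x y x' y' e e' ne => [[? ?]|t] [[? ?]|s] [[? ?]|t'] [[? ?]|s'] //= _ _ ne [c ec].
apply: (@K_distinct t s t' s'); last by exists c => r; apply: (ec (inr r)).
by apply: contraNneq ne => -[-> ->].
Qed.
End Distinctness.

(** Idempotency of [A] gives the diagonal cells different symbols, and their vanishing shared
    coordinates make them orthogonal to the corner. *)
Lemma composed_array_diag
    (A : M -> M -> M) (tag : M -> M -> option W)
    (U : M -> M -> N -> N -> C) (Q : M -> M -> option N -> option N -> option N -> C)
    (ca cb : W -> M -> M) (K : W -> W -> W -> C) :
    (forall a b, unitary_op (U a b)) ->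
    (forall a, A a a = a) ->
    (forall a b i j, tag a b = None -> Q a b i j None = 0) ->
    (forall a i j, dot (Q a a (Some i) (Some i)) (Q a a (Some j) (Some j)) = (i == j)%:R) ->
    (forall a i, Q a a (Some i) (Some i) None = 0) ->
    orthonormal_diag K ->
  orthonormal_diag (composed_array A tag U Q ca cb K).
Proof.
move=> uU A_idem Q_un Q_diag Q_diag0 K_diag.
have corner0 s b j : dot (composed_array A tag U Q ca cb K (inr s) (inr s))
    (composed_array A tag U Q ca cb K (inl (b, j)) (inl (b, j))) = 0.
  rewrite dot_point big1 => [|c _]; last by apply: big1 => k _; rewrite rmorph0 mul0r.
  by rewrite add0r; apply: big1 => r _ /=; rewrite Q_diag0 if_same mulr0.
case=> [[b j]|s] [[b' j']|s'].
- rewrite (inj_eq inl_inj) xpair_eqE /=; have [->|ne] := eqVneq b b'.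
    by rewrite dot_cell_same ?Q_diag.
  by rewrite dot_cell_disjoint ?A_idem.
- by rewrite -dot_conj corner0 rmorph0.
- by rewrite corner0.
rewrite (inj_eq inr_inj) -K_diag dot_point big1 ?add0r // => c _.
by apply: big1 => k _; rewrite rmorph0 mul0r.
Qed.
End Composition.

(** * The recursive construction from concrete ingredients *)

Section Recursion.
Variables (C : numClosedFieldType) (n : nat).
Local Notation N := 'I_n.

Definition ingredient (tagged : bool) (Q0 : N -> N -> N -> C)
    (Q1 : option N -> option N -> option N -> C) (i j k : option N) : C :=
  if tagged then Q1 i j k else
  if (i, j, k) is (Some i', Some j', Some k') then Q0 i' j' k' else 0.

Lemma dot_ingredient_untagged Q0 Q1 i j i' j' :
  dot (ingredient false Q0 Q1 (Some i) (Some j))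
      (ingredient false Q0 Q1 (Some i') (Some j')) = dot (Q0 i j) (Q0 i' j').
Proof. by rewrite /dot big_option /ingredient /= mulr0 add0r. Qed.

Lemma compose_has_imc (M W : finType) (A : M -> M -> M) (tag : M -> M -> option W)
    (ca cb : W -> M -> M) :
    (2 < n)%N ->
    (forall a, injective (A a)) -> (forall b, injective (A^~ b)) ->
    (forall a, A a a = a) ->
    (forall t a b, (tag a b == Some t) = (a == ca t b)) ->
    (forall t a b, (tag a b == Some t) = (b == cb t a)) ->
    (forall t, injective (fun b => A (ca t b) b)) ->
    (forall t, injective (fun a => A a (cb t a))) ->
    has_mc C n -> has_mc C n.+1 -> has_imc C #|W| ->
    (forall a, tag a a = None) /\ has_imc C n \/
      (forall a, isSome (tag a a)) /\ has_imc C n.+1 ->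
  has_imc C (#|M| * n + #|W|).
Proof.
move=> n2 A_row A_col A_idem tag_ca tag_cb A_ca A_cb mc0 mc1 imcW diag.
have [K [rK cK dK] iK] : exists2 K : W -> W -> W -> C, max_qls K & orthonormal_diag K.
  have [K [mK iK]] := imcW; have [K' mK' iK'] := max_qls_on (erefl #|W|) mK.
  by exists K' => //; apply: iK'.
(* An empty [M] could satisfy both alternatives about the diagonal; the inhabitant rules this
   out. *)
have [Q0 [r0 c0 d0] i0] : exists2 Q0 : N -> N -> N -> C, max_qls Q0 &
    (forall a, tag a a = None) -> (exists a : M, true) -> orthonormal_diag Q0.
  case: diag => [[_ [Q [mQ iQ]]]|[tagS _]]; first by exists Q.
  have [Q mQ] := mc0; exists Q => // tagN [a _].
  by have := tagS a; rewrite tagN.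
have card1 : #|{: option N}| = n.+1 by rewrite card_option card_ord.
have [Q1 [[r1 c1 d1] i1 Q1none]] : exists Q1 : option N -> option N -> option N -> C,
    [/\ max_qls Q1, (exists a, isSome (tag a a)) -> orthonormal_diag Q1
      & forall j k, Q1 None j k = (j == k)%:R].
  have [Q mQ iQ] : exists2 Q : 'I_n.+1 -> 'I_n.+1 -> 'I_n.+1 -> C, max_qls Q &
      (exists a, isSome (tag a a)) -> orthonormal_diag Q.
    case: diag => [[tagN _]|[_ [Q [mQ iQ]]]]; last by exists Q.
    by have [Q mQ] := mc1; exists Q => // -[a]; rewrite tagN.
  have [Q' mQ' iQ'] := max_qls_on card1 mQ.
  have [Q1 [mQ1 iQ1 Q1none]] := max_qls_normalize None mQ'.
  by exists Q1; split=> // /iQ /iQ' /iQ1.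
pose Q a b := ingredient (isSome (tag a b)) Q0 Q1.
have [U [uU U_gen]] := @exists_generic_unitaries C n (M * M)%type
  (M * M * (option N * option N))%type
  (fun x l => Q x.1.1 x.1.2 x.2.1 x.2.2 (Some l)) n2.
pose L := composed_array A tag (fun a b => U (a, b)) Q ca cb K.
have Q_un a b i j : tag a b = None -> Q a b i j None = 0.
  by rewrite /Q /ingredient => -> /=; case: i => // ?; case: j.
have Q_co a b k : isSome (tag a b) -> Q a b None None k = (k == None)%:R.
  by rewrite /Q /ingredient => ->; rewrite Q1none eq_sym.
have -> : (#|M| * n + #|W|)%N = #|{: M * N + W}| by rewrite card_sum card_prod card_ord.
apply: (@has_imcP C _ L); first split.
- apply: composed_array_rows => // a b i j j'.
  rewrite /valid /Q; case: (tag a b) => [t|] /=; first by move=> *; apply: r1.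
  case: i j j' => [i|] // [j|] // [j'|] // _ _ _.
  by rewrite dot_ingredient_untagged r0.
- apply: composed_array_cols => //.
    move=> a b i i' j; rewrite /valid /Q; case: (tag a b) => [t|] /=.
      by move=> _ _ _; apply: (c1 j).
    case: i i' j => [i|] // [i'|] // [j|] // _ _ _.
    by rewrite dot_ingredient_untagged (c0 j).
- move=> x y x' y'; apply: composed_array_distinct => //.
  + move=> a b i j a' b' i' j' ne nz nz'.
    exact: (U_gen _ _ (a, b, (i, j)) (a', b', (i', j'))).
  + move=> a b i j i' j'; rewrite /valid /Q; case: (tag a b) => [t|] /=.
      by move=> _ _ _ _; apply: d1.
    case: i j i' j' => [i|] // [j|] // [i'|] // [j'|] // _ _ _ _ ne [c e].
    apply: (d0 i j i' j'); first by apply: contraNneq ne => -[-> ->].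
    by exists c => k; apply: (e (Some k)).
  move=> a b i j; rewrite /valid /Q; case: (tag a b) => [t|] /=.
    (* An entry with zero block part would be proportional to the corner entry, against
       distinctness. *)
    move=> _ _ ne; apply/existsP; apply: contraPT (d1 _ _ _ _ ne).
    rewrite negb_exists => /forallP q0; apply; exists (Q1 i j None) => -[k|].
      by have := q0 k; rewrite negbK /ingredient => /eqP->; rewrite Q1none mulr0.
    by rewrite Q1none mulr1.
  case: i j => [i|] // [j|] // _ _ _; apply/existsP; apply: contraT.
  rewrite negb_exists => /forallP q0.
  have := r0 i j j; rewrite eqxx /dot big1 => [/esym/eqP|k _]; first by rewrite oner_eq0.
  by have := q0 k; rewrite negbK /ingredient => /eqP->; rewrite mulr0.
apply: composed_array_diag => // [a i j|a i].
  rewrite /Q; case et : (tag a a) => [t|] /=.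
    have iQ1 : orthonormal_diag Q1 by apply: i1; exists a; rewrite et.
    by rewrite /ingredient iQ1.
  have tagN : forall a, tag a a = None.
    by case: diag => [[]//|[tagS _]]; have := tagS a; rewrite et.
  by rewrite dot_ingredient_untagged (i0 tagN) //; exists a.
rewrite /Q; case et : (tag a a) => [t|] //=.
have iQ1 : orthonormal_diag Q1 by apply: i1; exists a; rewrite et.
(* The shared coordinate is the inner product with the corner, another diagonal entry of the
   idempotent [Q1]. *)
transitivity (dot (Q1 None None) (Q1 (Some i) (Some i))); last by rewrite iQ1.
by rewrite -(dot_unit None); apply: eq_dot => // k; rewrite Q1none eq_sym.
Qed.
End Recursion.

(** * Orders reached by composition *)

Section Closure.
Variable C : numClosedFieldType.

(* The idempotent Latin square [(a + b) / 2] on Z/m, whose transversals are the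
   diagonals [b - a = d]; the tagged ones are [d = s, ..., s + w - 1], so the
   main diagonal is tagged when [s = 0 < w]. *)
Lemma has_imc_odd_mul_add (m n w s : nat) :
    odd m -> (2 < m)%N -> (3 < n)%N -> has_imc C w -> (w + s <= m)%N ->
    (0 < s)%N /\ has_imc C n \/ [/\ s = 0%N, (0 < w)%N & has_imc C n.+1] ->
  has_imc C (m * n + w).
Proof.
move=> m_odd m2 n3 imcw ws imcn; have m1 : (1 < m)%N by apply: ltnW.
have two_unit : 2%:R \is a @GRing.unit 'Z_m.
  by rewrite unitZpE // coprimen2.
have dbl (a : 'Z_m) : a + a = a * 2%:R by rewrite mulr_natr.
pose A (a b : 'Z_m) : 'Z_m := (a + b) / 2%:R.
have A_inj (a b a' b' : 'Z_m) : A a b = A a' b' -> a + b = a' + b'.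
  by move=> e; apply: (mulIr (_ : 2%:R^-1 \is a GRing.unit)); rewrite ?unitrV.
pose d (t : 'I_w) : 'Z_m := (t + s)%:R.
have val_d t : d t = (t + s)%N :> nat.
  by rewrite val_Zp_nat // modn_small // (leq_trans _ ws) // ltn_add2r.
have d_inj : injective d.
  by move=> t u /(congr1 val); rewrite /= !val_d => /addIn/val_inj.
pose tag (a b : 'Z_m) := [pick t | b - a == d t].
have tagP t a b : (tag a b == Some t) = (b - a == d t).
  rewrite /tag; case: pickP => [u /eqP e|none]; last by rewrite none.
  by rewrite (inj_eq Some_inj) e (inj_eq d_inj).
have -> : (m * n + w = #|'Z_m| * n + #|'I_w|)%N by rewrite !card_ord Zp_cast.
apply: (@compose_has_imc C n _ _ A tag (fun t b => b - d t) (fun t a => a + d t)) => //.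
- exact: ltnW.
- by move=> a b b' /A_inj/addrI.
- by move=> b a a' /A_inj/addIr.
- by move=> a; rewrite /A dbl mulrK.
- by move=> t a b; rewrite tagP subr_eq addrC -subr_eq eq_sym.
- by move=> t a b; rewrite tagP subr_eq addrC.
(* On the diagonal [b - a = d] the sum [a + b] is [2 b - d], injective because 2 is invertible. *)
- move=> t b b' /A_inj; rewrite !(addrAC _ (- _)) => /addIr.
  by rewrite !dbl => /(mulIr two_unit).
- move=> t a a' /A_inj; rewrite !addrA => /addIr.
  by rewrite !dbl => /(mulIr two_unit).
- exact: has_mc_ge4.
- exact: has_mc_ge4 (ltnW _).
- by rewrite card_ord.
case: imcn => [[s0 imcn]|[s0 w0 imcn]]; [left|right]; split=> // a.
  rewrite /tag; case: pickP => // t; rewrite subrr => /eqP/(congr1 val) /=.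
  by rewrite val_d => /esym/eqP; rewrite addn_eq0 (gtn_eqF s0) andbF.
rewrite /tag; case: pickP => // /(_ (Ordinal w0)); rewrite subrr /d s0 /= addn0.
by rewrite eqxx.
Qed.

Definition latin_certificate (m : nat) (A : nat -> nat -> nat) : bool :=
  all (fun i => [&& A i i == i, all (fun j => A i j < m)%N (iota 0 m),
    uniq [seq A i j | j <- iota 0 m] & uniq [seq A j i | j <- iota 0 m]]) (iota 0 m).

(** With no transversals ([w = 0]) any idempotent Latin square serves, including those of even
    order. *)
Lemma latin_has_imc (m n : nat) (A : nat -> nat -> nat) :
  latin_certificate m A -> (3 < n)%N -> has_imc C n -> has_imc C (m * n).
Proof.
move=> /allP cert n3 imcn.
have certP (a : 'I_m) : [&& A a a == a, all (fun j => A a j < m)%N (iota 0 m),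
    uniq [seq A a j | j <- iota 0 m] & uniq [seq A j a | j <- iota 0 m]].
  by apply: cert; rewrite mem_iota ltn_ord.
have A_lt (a b : 'I_m) : (A a b < m)%N.
  by have /and4P[_ /allP/(_ b) + _ _] := certP a; apply; rewrite mem_iota ltn_ord.
have -> : (m * n = #|'I_m| * n + #|'I_0|)%N by rewrite !card_ord addn0.
apply: (@compose_has_imc C n _ _ (fun a b => Ordinal (A_lt a b)) (fun _ _ => None)
  (fun _ => id) (fun _ => id)) => //; try by case.
- exact: ltnW.
- move=> a b b' [e]; have /and4P[_ _ /mkseq_uniqP inj _] := certP a.
  by apply: val_inj; apply: inj; rewrite ?inE ?ltn_ord.
- move=> b a a' [e]; have /and4P[_ _ _ /(mkseq_uniqP (fun j => A j b)) inj] := certP b.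
  by apply: val_inj; apply: inj; rewrite ?inE ?ltn_ord.
- by move=> a; apply: val_inj; have /and4P[/eqP] := certP a.
- exact: has_mc_ge4.
- exact: has_mc_ge4 (ltnW _).
- by rewrite card_ord; apply: has_imc_small.
by left.
Qed.
End Closure.

(** * Computed closure of the small orders, and all large orders *)

Definition idempotent_latin4 (i j : nat) : nat :=
  nth 0%N (nth [::] [:: [:: 0; 2; 3; 1]; [:: 3; 1; 0; 2]; [:: 1; 3; 2; 0];
                      [:: 2; 0; 1; 3]] i)%N j.

Definition idempotent_latin6 (i j : nat) : nat :=
  nth 0%N (nth [::] [:: [:: 0; 2; 1; 4; 5; 3]; [:: 2; 1; 3; 5; 0; 4];
                      [:: 4; 5; 2; 0; 3; 1]; [:: 1; 4; 5; 3; 2; 0];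
                      [:: 5; 3; 0; 1; 4; 2]; [:: 3; 0; 4; 2; 1; 5]] i)%N j.

(** The alternatives: untagged diagonal with idempotent blocks of order [n], tagged diagonal with
    ingredients of order [n + 1], and the plain product with a Latin square of order 4 or 6. *)
Definition derivable (known : seq nat) (v m w : nat) : bool :=
  let n := ((v - w) %/ m)%N in
  [&& w <= v, m %| v - w, 3 < n &
    [&& odd m, 2 < m, (w \in 0 :: 1 :: known) &
        (w < m) && (n \in known) || (0 < w <= m) && (n.+1 \in known)]
    || [&& (m == 4) || (m == 6), w == 0 & n \in known]]%N.

Definition derive (known : seq nat) (v : nat) : seq nat :=
  if has (fun m => has (derivable known v m) [:: 0; 1; 7; 8; 9; 13]%N)
         [:: 3; 4; 5; 6; 7; 9; 11; 13; 15; 17]%N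
  then v :: known else known.

(** Orders 19 to 153 are visited upwards, so each may use the smaller ones already obtained. *)
Definition known_orders : seq nat :=
  foldl derive ([:: 8; 9; 15; 16]%N ++ [seq x.1.1.1.1 | x <- quadratic_certificates])
    (iota 19 135).

Definition open_orders : seq nat :=
  [:: 6; 8; 10; 12; 14; 18; 20; 24; 26; 30; 32; 38; 62]%N.

Section Closure.
Variable C : numClosedFieldType.

Lemma derivable_has_imc (known : seq nat) (v m w : nat) :
    {in known, forall u, has_imc C u} -> derivable known v m w -> has_imc C v.
Proof.
move=> imc /and4P[wv dv n3]; set n := ((v - w) %/ m)%N in n3 *.
have -> : v = (m * n + w)%N by rewrite mulnC divnK // subnK.
case/orP => [/and4P[m_odd m2 wk]|/and3P[m46 /eqP-> nk]]; last first.
  rewrite addn0; case/orP: m46 => /eqP->.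
    by apply: (@latin_has_imc C 4 n idempotent_latin4) => //; apply: imc.
  by apply: (@latin_has_imc C 6 n idempotent_latin6) => //; apply: imc.
have imcw : has_imc C w.
  move: wk; rewrite !inE => /or3P[/eqP->|/eqP->|/imc//]; exact: has_imc_small.
case/orP => /andP[lt nk].
  by apply: (@has_imc_odd_mul_add C m n w 1) => //; [rewrite addn1|left; split=> //; apply: imc].
case/andP: lt => w0 wm; apply: (@has_imc_odd_mul_add C m n w 0) => //; first by rewrite addn0.
by right; split=> //; apply: imc.
Qed.

Lemma known_orders_has_imc : {in known_orders, forall v, has_imc C v}.
Proof.
rewrite /known_orders; set base := (_ ++ _).
have : {in base, forall v, has_imc C v}.
  move=> v; rewrite mem_cat => /orP[|]; last exact: has_imc_prime.
  rewrite !inE => /or4P[] /eqP->;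
    [exact: has_imc8|exact: has_imc9|exact: has_imc15|exact: has_imc16].
elim: (iota _ _) base => [//|v r IHr] known imc; apply: IHr => u.
rewrite /derive; case: ifP => [/hasP[m _ /hasP[w _ dv]]|_]; last exact: imc.
by rewrite inE => /predU1P[->|/imc//]; apply: derivable_has_imc dv.
Qed.

Lemma known_orders_complete (v : nat) :
  (7 <= v < 154)%N -> v \notin open_orders -> v \in known_orders.
Proof.
move=> v_range v_open.
have /allP/(_ v) : all (fun u => (u \in open_orders) || (u \in known_orders)) (iota 7 147).
  by vm_compute.
by rewrite mem_iota v_range (negPf v_open) => /(_ isT).
Qed.

Lemma has_imc_small_range (v : nat) :
  (7 <= v < 154)%N -> v \notin open_orders -> has_imc C v.
Proof. by move=> vr vo; apply/known_orders_has_imc/known_orders_complete. Qed.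

Lemma has_imc_all (v : nat) : (6 <= v)%N -> v \notin open_orders -> has_imc C v.
Proof.
move=> v6 vo; have [v_small|v_big] := ltnP v 154.
  apply: has_imc_small_range => //; rewrite v_small andbT ltn_neqAle v6 andbT.
  by apply: contraNneq vo => <-.
(* No open order is odd. *)
have imc_odd w : odd w -> (7 <= w <= 19)%N -> has_imc C w.
  move=> wo wr; apply: has_imc_small_range; first by move: wr; lia.
  by move: wo wr; rewrite /open_orders !inE; lia.
have [v_odd|v_even] := boolP (odd v).
  (* The corner is odd and at most 17, while m is at least 23; the tagged diagonal asks for
     idempotent order 7. *)
  have -> : v = ((v %/ 12).*2.-1 * 6 + (v %% 12 + 6))%N by lia.
  apply: (@has_imc_odd_mul_add C _ _ _ 0) => //; try lia.
    by apply: imc_odd; lia.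
  by right; split; [|lia|exact: imc_odd].
(* The corner is odd and at most 19, and offset 1 requires [w + 1 <= m]; from 154 = 14 * 11 on, m is
   at least 21. *)
have -> : v = ((v %/ 14).*2.-1 * 7 + (v %% 14 + 7))%N by lia.
apply: (@has_imc_odd_mul_add C _ _ _ 1) => //; try lia.
  by apply: imc_odd; lia.
by left; split; [|exact: imc_odd].
Qed.
End Closure.

(** * Column vectors *)

Section Hilbert.
Variables (R : realType) (n : nat).

Definition vec_of (u : 'I_n -> complex R) : 'cV[complex R]_n := \col_k u k.

Lemma inner_vec_of (u w : 'I_n -> complex R) : inner (vec_of u) (vec_of w) = dot u w.
Proof. by apply: eq_bigr => k _; rewrite !mxE. Qed.

Lemma unit_vec_of (u : 'I_n -> complex R) : dot u u = 1 -> unit_vector (vec_of u).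
Proof. by rewrite /unit_vector /hnorm inner_vec_of => ->; apply: sqrtC1. Qed.

(** Pairing a linear relation with [e i] isolates its coefficient [c i], and n free vectors span
    dimension n. *)
Lemma orthonormal_basis_vec_of (e : 'I_n -> 'I_n -> complex R) :
  orthonormal_family e -> orthonormal_basis (fun i => vec_of (e i)).
Proof.
move=> oe; split=> [i|i j ij|]; first by apply: unit_vec_of; rewrite oe eqxx.
  by rewrite inner_vec_of oe (negPf ij).
set X := map _ _; have szX : size X = n by rewrite size_map size_enum_ord.
have dim_n : \dim {: 'cV[complex R]_n} = n by rewrite dimvf /dim /= muln1.
rewrite basisEfree subvf szX dim_n leqnn !andbT.
have szXb : size X == n by rewrite szX.
apply/(@freeP _ _ _ (Tuple szXb)) => c c0 i.
have nthX (j : 'I_n) : X`_j = vec_of (e j).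
  by rewrite (nth_map j) ?size_enum_ord // nth_ord_enum.
have : dot (e i) (fun k => \sum_j c j * e j k) = 0.
  rewrite /dot big1 // => k _; have /matrixP/(_ k 0) := c0.
  rewrite summxE mxE => ck.
  suff -> : \sum_j c j * e j k = 0 by rewrite mulr0.
  rewrite -[RHS]ck; apply: eq_bigr => j _.
  by transitivity ((c j *: X`_j) k 0); rewrite // nthX !mxE.
rewrite /dot; under eq_bigr => k _ do rewrite mulr_sumr.
rewrite exchange_big (bigD1 i) //= [X in _ + X]big1 => [|j /negPf ji].
  rewrite addr0 => <-; transitivity (c i * dot (e i) (e i)).
    by rewrite oe eqxx mulr1.
  by rewrite mulr_sumr; apply: eq_bigr => k _; rewrite mulrCA.
transitivity (c j * dot (e i) (e j)); last by rewrite oe eq_sym ji mulr0.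
by rewrite mulr_sumr; apply: eq_bigr => k _; rewrite mulrCA.
Qed.
End Hilbert.

Local Close Scope ring_scope.

Theorem theorem4p1 (R : realType) (v : nat) :
  (6 <= v)%N ->
  v \notin [:: 6; 8; 10; 12; 14; 18; 20; 24; 26; 30; 32; 38; 62] ->
  exists L : 'I_v -> 'I_v -> 'cV[complex R]_v,
    is_MCQLS L /\ idempotent_QLS L.
Proof.
move=> v6 v_open; have [L [[rL cL dL] iL]] := has_imc_all (complex R) v6 v_open.
have qL : is_QLS (fun i j => vec_of (L i j)).
  split=> [i j|i|j]; first by apply: unit_vec_of; rewrite rL eqxx.
    exact: orthonormal_basis_vec_of.
  exact: orthonormal_basis_vec_of.
exists (fun i j => vec_of (L i j)); do 2?split=> //.
  (* Equality up to phase is proportionality with a scalar of modulus one. *)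
  move=> i j k l ne [theta e]; apply: (dL i j k l ne); exists (expi theta) => x.
  by have /colP/(_ x) := e; rewrite !mxE.
exact: orthonormal_basis_vec_of.
Qed.
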